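(* $(\mathfrak h_3\oplus\mathbb R,S_0^1,J)$ is a second kind algebraic Ricci soliton with respect to $\nabla^0$ with $c=-\frac18$: the linear map $D$ represented in the basis $\{v_1,v_2,v_3,v_4\}$ by $$\begin{bmatrix}\frac18&0&0&0\\0&\frac18&0&0\\0&0&\frac38&-\frac18\\0&0&\frac18&\frac18\end{bmatrix}$$ is a derivation of $\mathfrak h_3\oplus\mathbb R$, and $\widetilde{\operatorname{Ric}}^0=-\frac18\operatorname{Id}+D$.
   Context: $\mathfrak h_3\oplus\mathbb R$ is the real Lie algebra with basis $e_1,e_2,e_3,e_4$ and only non-zero bracket (up to skew-symmetry) $[e_1,e_2]=e_3$. $S_0^1$ is the Lorentzian inner product $\langle\cdot,\cdot\rangle$ whose matrix in $(e_1,e_2,e_3,e_4)$ is $\begin{bmatrix}1&0&0&0\\0&1&0&0\\0&0&0&1\\0&0&1&0\end{bmatrix}$. Fix the basis $v_1=e_1$, $v_2=e_2$, $v_3=\frac1{\sqrt2}(e_3+e_4)$, $v_4=\frac1{\sqrt2}(e_3-e_4)$, which is orthonormal: $\langle v_i,v_j\rangle=0$ for $i\ne j$, $\langle v_i,v_i\rangle=1$ for $i=1,2,3$, $\langle v_4,v_4\rangle=-1$. The product structure $J$ is the linear map with $Jv_i=v_i$ for $i=1,2,3$ and $Jv_4=-v_4$. Write $\mathfrak g$ for the Lie algebra. The Levi-Civita connection is the bilinear map $\nabla:\mathfrak g\times\mathfrak g\to\mathfrak g$ with $2\langle\nabla_uv,w\rangle=\langle[u,v],w\rangle+\langle[w,u],v\rangle+\langle[w,v],u\rangle$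 for all $u,v,w$. Put $(\nabla_uJ)v=\nabla_u(Jv)-J(\nabla_uv)$. The canonical connection is $\nabla^0_uv=\nabla_uv-\frac12(\nabla_uJ)Jv$. Its curvature is $R^0_{uv}w=\nabla^0_{[u,v]}w-\nabla^0_u\nabla^0_vw+\nabla^0_v\nabla^0_uw$, its Ricci operator is $\operatorname{Ric}^0(u)=\sum_{k=1}^4\langle v_k,v_k\rangle R^0_{v_ku}v_k$, and $\rho^0(u,v)=\langle\operatorname{Ric}^0(u),v\rangle$. Put $\widetilde\rho^0(u,v)=\frac12(\rho^0(u,v)+\rho^0(v,u))$ and define $\widetilde{\operatorname{Ric}}^0$ by $\langle\widetilde{\operatorname{Ric}}^0(u),v\rangle=\widetilde\rho^0(u,v)$. A derivation of $\mathfrak g$ is a linear map $D:\mathfrak g\to\mathfrak g$ with $[D(u),v]+[u,D(v)]=D[u,v]$ for all $u,v\in\mathfrak g$. Second kind algebraic Ricci soliton with respect to $\nabla^0$ means $\widetilde{\operatorname{Ric}}^0=c\operatorname{Id}+D$ for some $c\in\mathbb R$ and some derivation $D$. In matrices, the $j$-th column contains the coordinates of the image of $v_j$ in the basis $(v_1,v_2,v_3,v_4)$. *)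

(* Defs.v *)
From HB Require Import structures.
From mathcomp Require Import all_boot all_order all_algebra.
From mathcomp Require Import reals.
From mathcomp Require Import ring lra.

Set Implicit Arguments.
Unset Strict Implicit.
Unset Printing Implicit Defensive.

Import Order.TTheory GRing.Theory Num.Theory.
Local Open Scope ring_scope.

(* Elements of h_3 (+) R are columns of coordinates in (e_1, e_2, e_3, e_4).  *)
(* Indices are shifted by one: [e i] is e_{i+1} and [v i] is v_{i+1}, i : 'I_4. *)

Definition mx4 (R : realType) (s : seq (seq R)) : 'M[R]_4 :=
  \matrix_(i, j) nth 0 (nth [::] s i) j.

Section H3R.
Context {R : realType}.
Local Notation V := 'cV[R]_4.

Definition e (i : 'I_4) : V := delta_mx i 0.

(* [e_1, e_2] = e_3, the other brackets of basis vectors being zero. *)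
Definition br (x y : V) : V := (x 0 0 * y 1 0 - x 1 0 * y 0 0) *: e 2.

Definition S01 : 'M[R]_4 :=
  mx4 [:: [:: 1; 0; 0; 0];
          [:: 0; 1; 0; 0];
          [:: 0; 0; 0; 1];
          [:: 0; 0; 1; 0]].

Definition ip (x y : V) : R := (x^T *m S01 *m y) 0 0.

Definition v (i : 'I_4) : V :=
  nth 0 [:: e 0; e 1;
            (Num.sqrt 2)^-1 *: (e 2 + e 3); (Num.sqrt 2)^-1 *: (e 2 - e 3)] i.

Definition vmx : 'M[R]_4 := \matrix_(i, j) v j i 0.

(* The linear map whose matrix in the basis (v_1, v_2, v_3, v_4) is M; see    *)
(* [linmap_v].                                                                *)
Definition linmap (M : 'M[R]_4) : {linear V -> V} :=
  mulmx (vmx *m M *m invmx vmx).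

Definition J : {linear V -> V} :=
  linmap (mx4 [:: [:: 1; 0; 0; 0];
                  [:: 0; 1; 0; 0];
                  [:: 0; 0; 1; 0];
                  [:: 0; 0; 0; -1]]).

(* For a linear form phi, the unique vector x with ip x w = phi w for all w;  *)
(* see [sharpP].                                                              *)
Definition sharp (phi : V -> R) : V :=
  \sum_(k < 4) (ip (v k) (v k) * phi (v k)) *: v k.

(* Levi-Civita connection, given by the Koszul formula; see [nablaP]. *)
Definition nabla (x y : V) : V :=
  sharp (fun w => 2^-1 * (ip (br x y) w + ip (br w x) y + ip (br w y) x)).

Definition nablaJ (x y : V) : V := nabla x (J y) - J (nabla x y).

Definition nabla0 (x y : V) : V := nabla x y - 2^-1 *: nablaJ x (J y).

Definition R0 (x y z : V) : V :=
  nabla0 (br x y) z - nabla0 x (nabla0 y z) + nabla0 y (nabla0 x z).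

Definition Ric0 (x : V) : V :=
  \sum_(k < 4) ip (v k) (v k) *: R0 (v k) x (v k).

Definition rho0 (x y : V) : R := ip (Ric0 x) y.

Definition rho0s (x y : V) : R := 2^-1 * (rho0 x y + rho0 y x).

(* See [Ric0sP]. *)
Definition Ric0s (x : V) : V := sharp (rho0s x).

Definition derivation (D : {linear V -> V}) : Prop :=
  forall x y : V, br (D x) y + br x (D y) = D (br x y).

Definition second_kind_soliton_with (c : R) : Prop :=
  exists D : {linear V -> V},
    derivation D /\ forall x : V, Ric0s x = c *: x + D x.

Lemma ord4_ind (P : 'I_4 -> Prop) : P 0 -> P 1 -> P 2 -> P 3 -> forall i, P i.
Proof.
move=> P0 P1 P2 P3 [[|[|[|[|//]]]] lti].
- by rewrite (_ : Ordinal lti = 0) //; apply/val_inj.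
- by rewrite (_ : Ordinal lti = 1) //; apply/val_inj.
- by rewrite (_ : Ordinal lti = 2) //; apply/val_inj.
- by rewrite (_ : Ordinal lti = 3) //; apply/val_inj.
Qed.

Lemma sum4 (W : nmodType) (F : 'I_4 -> W) :
  \sum_(k < 4) F k = F 0 + F 1 + F 2 + F 3.
Proof.
rewrite !big_ord_recl big_ord0 addr0 !addrA.
by congr (F _ + F _ + F _ + F _); apply/val_inj.
Qed.

Lemma br_alt (x : V) : br x x = 0.
Proof. by rewrite /br mulrC subrr scale0r. Qed.

Lemma br_anti (x y : V) : br y x = - br x y.
Proof. by rewrite /br -scaleNr; congr (_ *: _); ring. Qed.

Lemma br_linear_r (x : V) : linear (br x).
Proof.
by move=> a y z; rewrite /br !mxE scalerA -scalerDl; congr (_ *: _); ring.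
Qed.

Lemma br_jacobi (x y z : V) :
  br x (br y z) + br y (br z x) + br z (br x y) = 0.
Proof. by rewrite /br !mxE /= !mulr0 !subrr !scale0r !addr0. Qed.

Lemma br_e (i j : 'I_4) :
  br (e i) (e j) = if (i == 0) && (j == 1) then e 2
                   else if (i == 1) && (j == 0) then - e 2 else 0.
Proof.
by elim/ord4_ind: i; elim/ord4_ind: j;
  rewrite /br !mxE /= ?mulr0 ?mul0r ?mulr1 ?subrr ?subr0 ?sub0r
    ?scale0r ?scaleN1r ?scale1r.
Qed.

Lemma ipE (x y : V) :
  ip x y = x 0 0 * y 0 0 + x 1 0 * y 1 0 + x 2 0 * y 3 0 + x 3 0 * y 2 0.
Proof. by rewrite /ip !mxE sum4 !mxE !sum4 !mxE /=; ring. Qed.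

Lemma ip_sym (x y : V) : ip x y = ip y x.
Proof. by rewrite !ipE; ring. Qed.

Lemma ip_linear_r (x : V) : scalar (ip x).
Proof. by move=> a y y'; rewrite !ipE !mxE; ring. Qed.

Lemma ip_linear_l (y : V) : scalar (ip^~ y).
Proof. by move=> a x x'; rewrite !ipE !mxE; ring. Qed.

Lemma sqrt2V : (Num.sqrt 2 : R)^-1 * (Num.sqrt 2)^-1 = 2^-1.
Proof. by rewrite -invfM -expr2 sqr_sqrtr. Qed.

Lemma v_orthonormal (i j : 'I_4) :
  ip (v i) (v j) = if i == j then (if i == 3 then -1 else 1) else 0.
Proof.
have s := sqrt2V.
by elim/ord4_ind: i; elim/ord4_ind: j; rewrite ipE /v /= !mxE /=; lra.
Qed.

Lemma v_expand (x : V) : x = \sum_(k < 4) (ip (v k) (v k) * ip x (v k)) *: v k.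
Proof.
have s := sqrt2V; apply/colP => i.
rewrite sum4 !v_orthonormal /= !ipE /v !mxE /=.
elim/ord4_ind: i; rewrite /=.
- by ring.
- by ring.
- by transitivity (2 * ((Num.sqrt 2)^-1 * (Num.sqrt 2)^-1) * x 2 0);
    [rewrite s; field | ring].
- by transitivity (2 * ((Num.sqrt 2)^-1 * (Num.sqrt 2)^-1) * x 3 0);
    [rewrite s; field | ring].
Qed.

Lemma vmx_unit : vmx \in unitmx.
Proof.
pose W := \matrix_(k, i) (ip (v k) (v k) * ip (e i) (v k)).
have/mulmx1_unit[] // : vmx *m W = 1%:M.
apply/matrixP=> i j; rewrite !mxE.
have /(congr1 (fun c : V => c i 0)) := v_expand (e j).
rewrite mxE eqxx andbT => ->.
by rewrite summxE; apply: eq_bigr => k _; rewrite !mxE mulrC.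
Qed.

Lemma linmap_v (M : 'M[R]_4) (j : 'I_4) :
  linmap M (v j) = \sum_(i < 4) M i j *: v i.
Proof.
have vE k : v k = col k vmx by apply/colP=> i; rewrite !mxE.
rewrite /linmap /= vE !colE !mulmxA mulmxKV ?vmx_unit // -mulmxA -!colE.
apply/colP=> i; rewrite !mxE summxE; apply: eq_bigr => k _.
by rewrite !mxE mulrC.
Qed.

Lemma linmap_unique (M : 'M[R]_4) (f : {linear V -> V}) :
  (forall j, f (v j) = \sum_(i < 4) M i j *: v i) -> f =1 linmap M.
Proof.
move=> fv x; rewrite (v_expand x) !linear_sum; apply: eq_bigr => k _.
by rewrite !linearZ /= fv -linmap_v.
Qed.

Lemma J_v (i : 'I_4) : J (v i) = if i == 3 then - v i else v i.
Proof.
rewrite /J linmap_v sum4 !mxE.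
by elim/ord4_ind: i; rewrite /= !(scale0r, scale1r, scaleN1r, addr0, add0r).
Qed.

Lemma ip_inj (x y : V) : (forall w, ip x w = ip y w) -> x = y.
Proof.
by move=> xy; rewrite (v_expand x) (v_expand y); apply: eq_bigr => k _; rewrite xy.
Qed.

Lemma sharpP (phi : V -> R) (x : V) : scalar phi ->
  (forall w, ip x w = phi w) <-> x = sharp phi.
Proof.
move=> phi_lin; pose h : {scalar V} := HB.pack phi
  (GRing.isLinear.Build _ _ _ _ _ phi_lin).
have sharpE w : ip (sharp phi) w = phi w.
  rewrite {2}(v_expand w) -[phi]/(h : V -> R) linear_sum ip_sym.
  pose g : {scalar V} := HB.pack (ip w)
    (GRing.isLinear.Build _ _ _ _ _ (ip_linear_r w)).
  rewrite -[ip w _]/(g _) linear_sum; apply: eq_bigr => k _.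
  by rewrite !linearZ /=; ring.
split=> [xw|->]; last exact: sharpE.
by apply: ip_inj => w; rewrite xw sharpE.
Qed.

Lemma nablaP (nab : V -> V -> V) :
  (forall x y w, 2 * ip (nab x y) w
     = ip (br x y) w + ip (br w x) y + ip (br w y) x)
  <-> forall x y, nab x y = nabla x y.
Proof.
pose K x y w := 2^-1 * (ip (br x y) w + ip (br w x) y + ip (br w y) x).
have K_lin x y : scalar (K x y).
  by move=> a w w'; rewrite /K !ipE /br !mxE /=; ring.
split=> H x y.
  by apply/(sharpP _ (K_lin x y)) => w; rewrite /K -H mulKf // pnatr_eq0.
by move=> w; rewrite (iffRL (sharpP _ (K_lin x y)) (H x y)) mulVKf // pnatr_eq0.
Qed.

Lemma sharp_linear (a : R) (phi psi xi : V -> R) :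
  (forall w, xi w = a * phi w + psi w) ->
  sharp xi = a *: sharp phi + sharp psi.
Proof.
move=> xiE; rewrite /sharp scaler_sumr -big_split; apply: eq_bigr => k _ /=.
by rewrite xiE scalerA -scalerDl; congr (_ *: _); ring.
Qed.

Lemma nabla_linear_l (y : V) : linear (nabla^~ y).
Proof.
by move=> a x x'; apply: sharp_linear => w; rewrite !ipE /br !mxE /=; ring.
Qed.

Lemma nabla_linear_r (x : V) : linear (nabla x).
Proof.
by move=> a y y'; apply: sharp_linear => w; rewrite !ipE /br !mxE /=; ring.
Qed.

Lemma nabla0_linear_l (y : V) : linear (nabla0^~ y).
Proof.
move=> a x x'; rewrite /nabla0 /nablaJ !nabla_linear_l (linearP J).
move: (J (nabla x (J y))) (J (nabla x' (J y))) => *.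
move: (nabla x y) (nabla x' y) (nabla x (J (J y))) (nabla x' (J (J y))) => *.
by apply/colP=> i; rewrite !mxE; ring.
Qed.

Lemma nabla0_linear_r (x : V) : linear (nabla0 x).
Proof.
move=> a y y'; have JD := linearP J.
rewrite /nabla0 /nablaJ !(JD, nabla_linear_r).
move: (J (nabla x (J y))) (J (nabla x (J y'))) (nabla x y) (nabla x y').
move: (nabla x (J (J y))) (nabla x (J (J y'))) => *.
by apply/colP=> i; rewrite !mxE; ring.
Qed.

Lemma Ric0_linear : linear Ric0.
Proof.
move=> a x y; rewrite /Ric0 scaler_sumr -big_split; apply: eq_bigr => k _ /=.
rewrite /R0 br_linear_r !(nabla0_linear_l, nabla0_linear_r).
move: (nabla0 (br (v k) x) (v k)) (nabla0 (br (v k) y) (v k)) => *.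
move: (nabla0 x (nabla0 (v k) (v k))) (nabla0 y (nabla0 (v k) (v k))) => *.
move: (nabla0 (v k) (nabla0 x (v k))) (nabla0 (v k) (nabla0 y (v k))) => *.
move: (ip (v k) (v k)) => *.
by apply/colP=> i; rewrite !mxE; ring.
Qed.

Lemma Ric0sP (F : V -> V) :
  (forall x y, ip (F x) y = rho0s x y) <-> forall x, F x = Ric0s x.
Proof.
have rho0s_lin x : scalar (rho0s x).
  move=> a y z; rewrite /rho0s /rho0 (Ric0_linear a y z).
  by move: (Ric0 x) (Ric0 y) (Ric0 z) => *; rewrite !ipE !mxE; ring.
split=> H x; first exact/(sharpP _ (rho0s_lin x)).
exact/(sharpP _ (rho0s_lin x)).
Qed.

End H3R.

(* Main.v *)
Require Import Defs.
From mathcomp Require Import all_boot all_order all_algebra.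
From mathcomp Require Import reals.
From mathcomp Require Import ring.
Import Order.TTheory GRing.Theory Num.Theory.
Local Open Scope ring_scope.

(** In the basis (e_1, e_2, e_3, e_4) the factors sqrt 2 disappear: J swaps
    e_3 and e_4, the metric trace becomes
    B(e_1,e_1) + B(e_2,e_2) + B(e_3,e_4) + B(e_4,e_3), and every tensor involved
    is polynomial in the coordinates with rational coefficients.  One finds
    Ric^0(x) = x_4/4 (e_3 + e_4), and D is the derivation
    e_1 -> e_1/8, e_2 -> e_2/8, e_3 -> e_3/4, e_4 -> (e_3 + e_4)/4. *)

Definition vec4 {R : realType} (a b c d : R) : 'cV[R]_4 :=
  \col_i nth 0 [:: a; b; c; d] i.

Lemma cV4P (R : realType) (x y : 'cV[R]_4) :
  x 0 0 = y 0 0 -> x 1 0 = y 1 0 -> x 2 0 = y 2 0 -> x 3 0 = y 3 0 -> x = y.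
Proof. by move=> *; apply/colP; elim/ord4_ind. Qed.

Lemma vec4_eta (R : realType) (x : 'cV[R]_4) :
  x = vec4 (x 0 0) (x 1 0) (x 2 0) (x 3 0).
Proof. by apply: cV4P; rewrite mxE. Qed.

Lemma e_vec4 (R : realType) :
  (e 0 = @vec4 R 1 0 0 0) * (e 1 = @vec4 R 0 1 0 0) *
  (e 2 = @vec4 R 0 0 1 0) * (e 3 = @vec4 R 0 0 0 1).
Proof. by do !split; apply: cV4P; rewrite !mxE. Qed.

Lemma vec4D (R : realType) (a b c d a' b' c' d' : R) :
  vec4 a b c d + vec4 a' b' c' d' =
  vec4 (a + a') (b + b') (c + c') (d + d').
Proof. by apply: cV4P; rewrite !mxE. Qed.

Lemma vec4Z (R : realType) (k a b c d : R) :
  k *: vec4 a b c d = vec4 (k * a) (k * b) (k * c) (k * d).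
Proof. by apply: cV4P; rewrite !mxE. Qed.

Lemma vec4N (R : realType) (a b c d : R) :
  - vec4 a b c d = vec4 (- a) (- b) (- c) (- d).
Proof. by apply: cV4P; rewrite !mxE. Qed.

Lemma br_vec4 (R : realType) (a b c d a' b' c' d' : R) :
  br (vec4 a b c d) (vec4 a' b' c' d') = vec4 0 0 (a * b' - b * a') 0.
Proof. by apply: cV4P; rewrite !mxE /= ?mulr0 ?mulr1. Qed.

Lemma ip_vec4 (R : realType) (a b c d a' b' c' d' : R) :
  ip (vec4 a b c d) (vec4 a' b' c' d') = a * a' + b * b' + c * d' + d * c'.
Proof. by rewrite ipE !mxE. Qed.

(** Polarization: [v 2] and [v 3] have opposite signs, so they contribute half the difference of the
    values of [B] on the diagonal at [e 2 + e 3] and [e 2 - e 3]. The pure terms cancel and the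
    mixed ones remain. *)
Lemma ip_trace (R : realType) (W : lmodType R)
    (B : 'cV[R]_4 -> 'cV[R]_4 -> W) :
  (forall y, linear (B^~ y)) -> (forall x, linear (B x)) ->
  \sum_(k < 4) ip (v k) (v k) *: B (v k) (v k) =
  B (e 0) (e 0) + B (e 1) (e 1) + B (e 2) (e 3) + B (e 3) (e 2).
Proof.
move=> Bl Br.
have BlD x x' y : B (x + x') y = B x y + B x' y.
  by rewrite -[x]scale1r Bl !scale1r.
have BrD x y y' : B x (y + y') = B x y + B x y'.
  by rewrite -[y]scale1r Br !scale1r.
have B0l y : B 0 y = 0 by apply: (addrI (B 0 y)); rewrite -BlD !addr0.
have B0r x : B x 0 = 0 by apply: (addrI (B x 0)); rewrite -BrD !addr0.
have BlZ a x y : B (a *: x) y = a *: B x y.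
  by rewrite -[a *: x]addr0 Bl B0l addr0.
have BrZ a x y : B x (a *: y) = a *: B x y.
  by rewrite -[a *: y]addr0 Br B0r addr0.
have BN x y : B (x - y) (x - y) = B x x - B x y - (B y x - B y y).
  rewrite -[- y]scaleN1r BlD !BrD !(BlZ, BrZ) !scaleN1r opprK opprB.
  by rewrite [- _ + _]addrC.
rewrite sum4 !v_orthonormal /= /v /= !(BlZ, BrZ) !scalerA -!mulrA sqrt2V.
rewrite !scale1r mul1r mulN1r scaleNr -!addrA; congr (_ + (_ + _)).
rewrite -scalerBr BN BlD !BrD.
set p := B (e 2) (e 2); set q := B (e 2) (e 3).
set r := B (e 3) (e 2); set t := B (e 3) (e 3).
rewrite (_ : _ - _ = (q + r) *+ 2).
  by rewrite -scaler_nat scalerA mulVf ?pnatr_eq0 ?scale1r.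
(* The permutation collects [q + r] twice and puts [p] and [t] next to their opposites. *)
rewrite !opprB !addrA (ACl ((2*3)*(7*5)*((1*8)*(4*6)))) /=.
by rewrite !subrr !addr0 mulr2n.
Qed.

(** [sharp phi] is the metric trace of the bilinear map sending x, y to [phi x *: y]. The last two
    values are swapped because [e 2] and [e 3] are null and dual to each other. *)
Lemma sharp_vec4 (R : realType) (phi : 'cV[R]_4 -> R) : scalar phi ->
  sharp phi = vec4 (phi (e 0)) (phi (e 1)) (phi (e 3)) (phi (e 2)).
Proof.
move=> phi_lin; rewrite /sharp.
under eq_bigr do rewrite -scalerA.
rewrite (ip_trace _ _ (fun x y => phi x *: y)).
- by apply: cV4P; rewrite !mxE /=; ring.
- by move=> y a x x'; rewrite phi_lin scalerDl scalerA.
- by move=> x a y y'; rewrite scalerDr !scalerA mulrC.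
Qed.

Lemma sqr_sqrt2V (R : realType) : (Num.sqrt 2 : R)^-1 ^+ 2 * 2 = 1.
Proof. by rewrite expr2 sqrt2V mulVf ?pnatr_eq0. Qed.

Lemma v_vec4 (R : realType) (r := (Num.sqrt 2 : R)^-1) :
  (v 0 = @vec4 R 1 0 0 0) * (v 1 = @vec4 R 0 1 0 0) *
  (v 2 = @vec4 R 0 0 r r) * (v 3 = @vec4 R 0 0 r (- r)).
Proof.
rewrite /v /= !e_vec4 !(vec4N, vec4D, vec4Z).
by rewrite !(addr0, add0r, oppr0, mulr0, mulr1, mulrN).
Qed.

Lemma linmap_vec4 (R : realType) (M : 'M[R]_4) (a b c d : R) :
  linmap M (vec4 a b c d) =
  a *: linmap M (v 0) + b *: linmap M (v 1) +
  ((Num.sqrt 2)^-1 * (c + d)) *: linmap M (v 2) +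
  ((Num.sqrt 2)^-1 * (c - d)) *: linmap M (v 3).
Proof.
have -> : vec4 a b c d =
    a *: v 0 + b *: v 1 +
    ((Num.sqrt 2)^-1 * (c + d)) *: v 2 + ((Num.sqrt 2)^-1 * (c - d)) *: v 3.
  rewrite !v_vec4 !(vec4Z, vec4D).
  by move: (Num.sqrt 2)^-1 (sqr_sqrt2V R) => r s; congr vec4; ring: s.
by move: (v 0) (v 1) (v 2) (v 3) => *; rewrite !linearD !linearZ.
Qed.

Lemma J_vec4 (R : realType) (a b c d : R) :
  J (vec4 a b c d) = vec4 a b d c.
Proof.
rewrite /J linmap_vec4 !linmap_v !sum4 !mxE /= !v_vec4 !(vec4D, vec4Z).
by move: (Num.sqrt 2)^-1 (sqr_sqrt2V R) => r s; congr vec4; ring: s.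
Qed.

(** The last coordinate is the Koszul form at [e 2]; it vanishes because [e 2] is central and
    orthogonal to all brackets. *)
Lemma nabla_vec4 (R : realType) (a b c d a' b' c' d' : R) :
  nabla (vec4 a b c d) (vec4 a' b' c' d') =
  vec4 ((b * d' + b' * d) / 2) (- (a * d' + a' * d) / 2)
         ((a * b' - b * a') / 2) 0.
Proof.
rewrite /nabla sharp_vec4 => [|k w w'].
  by rewrite !e_vec4 !br_vec4 !ip_vec4; congr vec4; field.
by rewrite [w]vec4_eta [w']vec4_eta vec4Z vec4D !br_vec4 !ip_vec4; ring.
Qed.

(** Since J squares to the identity, [nabla0 x y] is the average of [nabla x y] and
    [J (nabla x (J y))]; this makes its last two coordinates equal. *)
Lemma nabla0_vec4 (R : realType) (a b c d a' b' c' d' : R) :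
  nabla0 (vec4 a b c d) (vec4 a' b' c' d') =
  vec4 ((b * (c' + d') + 2 * b' * d) / 4) (- (a * (c' + d') + 2 * a' * d) / 4)
         ((a * b' - b * a') / 4) ((a * b' - b * a') / 4).
Proof.
rewrite /nabla0 /nablaJ !J_vec4 !nabla_vec4 !J_vec4 !(vec4N, vec4D, vec4Z).
by congr vec4; field.
Qed.

Lemma br_linear_l (R : realType) (y : 'cV[R]_4) : linear (br^~ y).
Proof.
by move=> a x x'; rewrite !(br_anti y) br_linear_r scalerN opprD.
Qed.

(** The sign pattern is that of the three terms of [R0]. *)
Lemma scaler_combine3 (R : pzRingType) (W : lmodType R) (a : R)
    (x y z x' y' z' : W) :
  a *: x + x' - (a *: y + y') + (a *: z + z') =
  a *: (x - y + z) + (x' - y' + z').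
Proof.
by rewrite !scalerDr scalerN opprD (addrACA (a *: x)) [LHS]addrACA.
Qed.

Lemma R0_linear_l (R : realType) (y z : 'cV[R]_4) :
  linear (fun x => R0 x y z).
Proof.
move=> a x x'; rewrite /R0 br_linear_l !nabla0_linear_l nabla0_linear_r.
exact: scaler_combine3.
Qed.

Lemma R0_linear_r (R : realType) (x y : 'cV[R]_4) : linear (R0 x y).
Proof.
move=> a z z'; rewrite /R0 !nabla0_linear_r.
exact: scaler_combine3.
Qed.

Lemma Ric0_vec4 (R : realType) (a b c d : R) :
  Ric0 (vec4 a b c d) = vec4 0 0 (d / 4) (d / 4).
Proof.
(* The Ricci operator is a metric trace over the first and third arguments of the curvature, so it
   can be computed in the basis [e]. *)
rewrite /Ric0 (ip_trace _ _ (fun y z => R0 y _ z)).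
- rewrite /R0 !e_vec4 !br_vec4 !nabla0_vec4 !(vec4N, vec4D).
  by congr vec4; field.
- by move=> z; apply: R0_linear_l.
- by move=> y; apply: R0_linear_r.
Qed.

(** Here [rho0 x y] is x_4 (y_3 + y_4) / 4; symmetrizing splits x_4 y_3 / 4 into (x_4 y_3 + x_3 y_4)
    / 8. *)
Lemma Ric0s_vec4 (R : realType) (a b c d : R) :
  Ric0s (vec4 a b c d) = vec4 0 0 (c / 8 + d / 4) (d / 8).
Proof.
rewrite /Ric0s /rho0s /rho0 sharp_vec4 => [|k w w'].
  by rewrite !e_vec4 !Ric0_vec4 !ip_vec4; congr vec4; field.
by rewrite [w]vec4_eta [w']vec4_eta vec4Z vec4D !Ric0_vec4 !ip_vec4; ring.
Qed.

Theorem theorem4p7 (R : realType) :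
  let D : {linear 'cV[R]_4 -> 'cV[R]_4} :=
    linmap (mx4 [:: [:: 8^-1; 0;    0;     0];
                    [:: 0;    8^-1; 0;     0];
                    [:: 0;    0;    3 / 8; - 8^-1];
                    [:: 0;    0;    8^-1;  8^-1]]) in
  [/\ second_kind_soliton_with (- 8^-1 : R),
      derivation D &
      forall x : 'cV[R]_4, Ric0s x = (- 8^-1) *: x + D x].
Proof.
move=> D.
have DE a b c d :
    D (vec4 a b c d) = vec4 (a / 8) (b / 8) ((c + d) / 4) (d / 4).
  rewrite /D linmap_vec4 !linmap_v !sum4 !mxE /= !v_vec4 !(vec4D, vec4Z).
  move: (Num.sqrt 2)^-1 (sqr_sqrt2V R) => r s; congr vec4.
  - by field.
  - by field.
  (* The left side is homogeneous of degree 2 in r; multiplying the right side by r^2 * 2 = 1 gives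
     an identity valid for every r. *)
  - by rewrite -[RHS]mul1r -[X in _ = X * _]s; field.
  - by rewrite -[RHS]mul1r -[X in _ = X * _]s; field.
(* The weights match, 1/8 + 1/8 = 1/4 on [e_1, e_2] = e_3, and D maps the central e_4 into the
   centre. *)
have Dder : derivation D.
  move=> x y; rewrite [x]vec4_eta [y]vec4_eta !DE !br_vec4 vec4D DE.
  by congr vec4; field.
have RicD x : Ric0s x = (- 8^-1) *: x + D x.
  by rewrite [x]vec4_eta Ric0s_vec4 DE vec4Z vec4D; congr vec4; field.
by split=> //; exists D.
Qed.
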